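(* Let $M\in\mathbb{R}^{d\times d}$ be symmetric positive definite, let $S\in\mathbb{R}^{d\times d}$ be constant with $S^\top=-S$ or $S\preceq0$, and let $V:\mathbb{R}^d\to\mathbb{R}$ be differentiable. Let $h>0$, and let $z^n,z^{n+1}\in\mathbb{R}^d$ and $\eta^{n+\frac12}\in\mathbb{R}$ satisfy one step of the LM/CN scheme, with precomputed predictor $\hat z=\hat z^{\,n+\frac12}\in\mathbb{R}^d$: $$\frac{z^{n+1}-z^n}{h}=S\mu^{n+\frac12},\qquad \mu^{n+\frac12}=M\,\frac{z^{n+1}+z^n}{2}+\eta^{n+\frac12}\nabla V(\hat z),$$ $$V(z^{n+1})-V(z^n)=\eta^{n+\frac12}\,\nabla V(\hat z)^\top(z^{n+1}-z^n).$$ Write $\tilde z^k=[(z^k)^\top,V(z^k)]^\top$ and $H(\tilde z)=\tfrac12z^\top Mz+V$ for $\tilde z=[z^\top,V]^\top$. Then $$H(\tilde z^{n+1})-H(\tilde z^n)=h\Big[\nabla H\Big(\tfrac{\tilde z^n+\tilde z^{n+1}}2\Big)\Big]^\top\tilde S(\hat z)\,\nabla H\Big(\tfrac{\tilde z^n+\tilde z^{n+1}}2\Big)=h\,\big(\mu^{n+\frac12},S\mu^{n+\frac12}\big),$$ and the method is unconditionally energy-stable (for every $h>0$): $$H(\tilde z^{n+1})=H(\tilde z^n)\ \text{ if } S^\top=-S,\qquad H(\tilde z^{n+1})\le H(\tilde z^n)\ \text{ if } S\preceq0 .$$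
   Context: $S\preceq0$ means that $\operatorname{sym}(S)=\tfrac12(S+S^\top)$ is negative semidefinite ($S$ need not be symmetric). $(\cdot,\cdot)$ is the Euclidean inner product. In $H(\tilde z)$ the last component $V$ of $\tilde z$ is treated as an independent coordinate, so $\nabla H(\tilde z)=[(Mz)^\top,1]^\top$. On the numerical solution, $H(\tilde z^k)=\tfrac12(z^k)^\top Mz^k+V(z^k)$. The frozen structure matrix is $$\tilde S(\hat z)=\begin{bmatrix} S & \eta^{n+\frac12}S\nabla V(\hat z)\\ \eta^{n+\frac12}\nabla V(\hat z)^\top S & (\eta^{n+\frac12})^2\,\nabla V(\hat z)^\top S\nabla V(\hat z)\end{bmatrix}.$$ The vector $\hat z^{\,n+\frac12}$ is an input to the step, computed beforehand; in practice it is a locally second-order approximation of the solution at $t_n+h/2$. *)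

(* Defs.v *)
From HB Require Import structures.
From mathcomp Require Import all_boot all_order all_algebra.
From mathcomp Require Import all_classical all_reals all_analysis.

Set Implicit Arguments.
Unset Strict Implicit.
Unset Printing Implicit Defensive.

Import Order.TTheory GRing.Theory Num.Theory.
Import numFieldNormedType.Exports.

Local Open Scope ring_scope.

Definition dotv (R : realType) (n : nat) (u v : 'cV[R]_n) : R :=
  (u^T *m v) 0 0.

(* Column vector of partial derivatives: the Euclidean gradient wherever f is
   differentiable. *)
Definition grad (R : realType) (n : nat) (f : 'cV[R]_n -> R) (x : 'cV[R]_n)
  : 'cV[R]_n :=
  \col_i 'D_(delta_mx i 0) f x.

Definition sympart (R : realType) (n : nat) (A : 'M[R]_n) : 'M[R]_n :=
  2^-1 *: (A + A^T).

Definition sym_posdef (R : realType) (n : nat) (A : 'M[R]_n) : Prop :=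
  A^T = A /\ forall x : 'cV[R]_n, x != 0 -> 0 < dotv x (A *m x).

Definition sym_negsemidef (R : realType) (n : nat) (A : 'M[R]_n) : Prop :=
  A^T = A /\ forall x : 'cV[R]_n, dotv x (A *m x) <= 0.

(* The relation S <= 0 for a matrix S that need not be symmetric. *)
Definition negsemidef (R : realType) (n : nat) (S : 'M[R]_n) : Prop :=
  sym_negsemidef (sympart S).

Definition lift_state (R : realType) (d : nat) (V : 'cV[R]_d -> R)
  (z : 'cV[R]_d) : 'cV[R]_(d + 1) :=
  col_mx z (V z)%:M.

(* The last component of y is an independent coordinate, so that
   grad (energy M) is taken in R^(d + 1). *)
Definition energy (R : realType) (d : nat) (M : 'M[R]_d) (y : 'cV[R]_(d + 1))
  : R :=
  2^-1 * dotv (usubmx y) (M *m usubmx y) + dsubmx y 0 0.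

Definition frozen_struct (R : realType) (d : nat) (S : 'M[R]_d)
  (V : 'cV[R]_d -> R) (eta : R) (zhat : 'cV[R]_d) : 'M[R]_(d + 1) :=
  let g := grad V zhat in
  block_mx S                      (eta *: (S *m g))
           (eta *: (g^T *m S))    (eta ^+ 2 *: (g^T *m S *m g)).

(* Main.v *)
Require Import Defs.
From HB Require Import structures.
From mathcomp Require Import all_boot all_order all_algebra.
From mathcomp Require Import all_classical all_reals all_analysis.
From mathcomp Require Import ring.
Import Order.TTheory GRing.Theory Num.Theory.
Import numFieldNormedType.Exports.
Local Open Scope ring_scope.

Set Implicit Arguments.
Unset Strict Implicit.
Unset Printing Implicit Defensive.

(** The scheme is a discrete-gradient method in disguise.  Since [M] is
    symmetric, the increment of the quadratic energy over a step is
    [dotv (M zbar) (z1 - z0)], where [zbar] is the midpoint, and the Lagrange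
    multiplier relation makes the increment of [V] equal to
    [dotv (eta *: grad V zhat) (z1 - z0)].  The two add up to
    [dotv mu (z1 - z0)], which is [h * dotv mu (S *m mu)] by the first
    equation of the scheme ([energy_increment]).  On the other hand
    [grad (energy M) y = col_mx (M *m usubmx y) 1] ([grad_energy]), and the
    frozen structure matrix is [S] pulled back along
    [col_mx x c |-> x + c *: (eta *: grad V zhat)], a map that sends the
    midpoint gradient to [mu] ([frozen_struct_quad]).  Stability is then the
    sign of the quadratic form of [S], which sees only the symmetric part of
    [S] ([dotv_sympart]). *)

Section Dotv.
Variables (R : realType) (n : nat).
Implicit Types (u v w : 'cV[R]_n) (A : 'M[R]_n) (a : R).

Lemma dotvC u v : dotv u v = dotv v u.
Proof. by rewrite /dotv !mxE; apply: eq_bigr => i _; rewrite !mxE mulrC. Qed.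

Lemma dotvDr u v w : dotv u (v + w) = dotv u v + dotv u w.
Proof. by rewrite /dotv mulmxDr mxE. Qed.

Lemma dotvZr a u v : dotv u (a *: v) = a * dotv u v.
Proof. by rewrite /dotv -scalemxAr mxE. Qed.

Lemma dotvBr u v w : dotv u (v - w) = dotv u v - dotv u w.
Proof. by rewrite -scaleN1r dotvDr dotvZr mulN1r. Qed.

Lemma dotvDl u v w : dotv (u + v) w = dotv u w + dotv v w.
Proof. by rewrite dotvC dotvDr !(dotvC w). Qed.

Lemma dotvZl a u v : dotv (a *: u) v = a * dotv u v.
Proof. by rewrite dotvC dotvZr dotvC. Qed.

Lemma dotv_trmx A u v : dotv u (A *m v) = dotv (A^T *m u) v.
Proof. by rewrite /dotv trmx_mul trmxK mulmxA. Qed.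

Lemma dotv_delta u i : dotv u (delta_mx i 0) = u i 0.
Proof. by rewrite /dotv -colE !mxE. Qed.

Lemma dotv_sympart A u : dotv u (sympart A *m u) = dotv u (A *m u).
Proof.
rewrite /sympart -scalemxAl mulmxDl dotvZr dotvDr (dotv_trmx A^T) trmxK.
by rewrite (dotvC (A *m u)); field.
Qed.

Lemma negsemidef_dotv_le0 A u : negsemidef A -> dotv u (A *m u) <= 0.
Proof. by move=> [_ /(_ u)]; rewrite dotv_sympart. Qed.

Lemma dotv_skew A u : A^T = - A -> dotv u (A *m u) = 0.
Proof.
move=> skewA; rewrite -dotv_sympart /sympart skewA subrr scaler0 mul0mx.
by rewrite /dotv mulmx0 mxE.
Qed.

End Dotv.

Lemma dotv_col_mx (R : realType) (m n : nat) (u v : 'cV[R]_(m + n)) :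
  dotv u v = dotv (usubmx u) (usubmx v) + dotv (dsubmx u) (dsubmx v).
Proof.
rewrite /dotv -{1}[u]vsubmxK -{1}[v]vsubmxK tr_col_mx mul_row_col.
by rewrite mxE.
Qed.

Lemma dotv_1l (R : realType) (x : 'cV[R]_1) : dotv 1 x = x 0 0.
Proof. by rewrite /dotv trmx1 mul1mx. Qed.

Section Energy.
Variables (R : realType) (d : nat) (M : 'M[R]_d).
Hypothesis symM : M^T = M.

Lemma energy_expand (y v : 'cV[R]_(d + 1)) (t : R) :
  energy M (t *: v + y) =
  energy M y + t * dotv (col_mx (M *m usubmx y) 1) v
  + t ^+ 2 * (2^-1 * dotv (usubmx v) (M *m usubmx v)).
Proof.
rewrite (dotv_col_mx _ v) col_mxKu col_mxKd dotv_1l /energy.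
have -> : usubmx (t *: v + y) = t *: usubmx v + usubmx y.
  by apply/matrixP=> i j; rewrite !mxE.
have -> : dsubmx (t *: v + y) 0 0 = t * dsubmx v 0 0 + dsubmx y 0 0.
  by rewrite !mxE.
rewrite mulmxDr -scalemxAr !dotvDl !dotvDr !dotvZl !dotvZr.
have -> : dotv (usubmx y) (M *m usubmx v) = dotv (M *m usubmx y) (usubmx v).
  by rewrite dotv_trmx symM.
by rewrite (dotvC (usubmx v) (M *m usubmx y)); field.
Qed.

Lemma derive_energy (y v : 'cV[R]_(d + 1)) :
  'D_v (energy M) y = dotv (col_mx (M *m usubmx y) 1) v.
Proof.
set B := dotv _ v; set C := 2^-1 * dotv (usubmx v) (M *m usubmx v).
apply: cvg_lim => //.
(* Off 0 the difference quotient is affine in the increment. *)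
apply: (@cvg_trans _ ((fun t : R => B + t * C) @ 0^')%classic).
  apply: near_eq_cvg; near=> t.
  have t0 : t != 0 by near: t; exact: nbhs_dnbhs_neq.
  rewrite /= energy_expand -/B -/C /GRing.scale /=.
  by field.
suff : ((fun t : R => B + t * C) @ 0^' --> B + 0 * C)%classic
  by rewrite mul0r addr0.
apply: cvgD; first exact: cvg_cst.
apply: cvgM; last exact: cvg_cst.
exact: nbhs_dnbhs.
Unshelve. all: by end_near. Qed.

Lemma grad_energy (y : 'cV[R]_(d + 1)) :
  grad (energy M) y = col_mx (M *m usubmx y) 1.
Proof.
by apply/colP => i; rewrite mxE derive_energy dotv_delta.
Qed.

Lemma energy_lift_stateB (V : 'cV[R]_d -> R) (z0 z1 : 'cV[R]_d) :
  energy M (lift_state V z1) - energy M (lift_state V z0) =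
  dotv (M *m (2^-1 *: (z1 + z0))) (z1 - z0) + (V z1 - V z0).
Proof.
rewrite /energy !col_mxKu !col_mxKd !mxE eqxx !mulr1n.
rewrite -scalemxAr dotvZl mulmxDr dotvDl !dotvBr.
rewrite -!(dotvC _ (M *m _)).
have -> : dotv z1 (M *m z0) = dotv z0 (M *m z1) by rewrite dotv_trmx symM dotvC.
by field.
Qed.

End Energy.

(** With [g = grad V zhat], the frozen structure matrix is [B^T *m S *m B]
    for [B = row_mx 1%:M (eta *: g)]. *)
Lemma frozen_struct_quad (R : realType) (d : nat) (S : 'M[R]_d)
    (V : 'cV[R]_d -> R) (eta : R) (zhat x : 'cV[R]_d) :
  let w := x + eta *: grad V zhat in
  dotv (col_mx x 1) (frozen_struct S V eta zhat *m col_mx x 1)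
  = dotv w (S *m w).
Proof.
rewrite /= /frozen_struct; set g := grad V zhat.
rewrite mul_block_col !mulmx1 dotv_col_mx !col_mxKu !col_mxKd dotv_1l.
rewrite mulmxDr -scalemxAr dotvDl !dotvDr !dotvZl !dotvZr.
have entryD (A B : 'M[R]_1) : (A + B) 0 0 = A 0 0 + B 0 0 by rewrite mxE.
have entryZ (a : R) (A : 'M[R]_1) : (a *: A) 0 0 = a * A 0 0 by rewrite mxE.
rewrite -!scalemxAl entryD !entryZ -!mulmxA -!/(dotv _ _).
by ring.
Qed.

Lemma energy_increment (R : realType) (d : nat) (M S : 'M[R]_d)
    (V : 'cV[R]_d -> R) (h eta : R) (z0 z1 g mu : 'cV[R]_d) :
  M^T = M -> h != 0 -> h^-1 *: (z1 - z0) = S *m mu ->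
  mu = M *m (2^-1 *: (z1 + z0)) + eta *: g ->
  V z1 - V z0 = eta * dotv g (z1 - z0) ->
  energy M (lift_state V z1) - energy M (lift_state V z0)
  = h * dotv mu (S *m mu).
Proof.
move=> symM h0 step mu_def eta_def.
rewrite energy_lift_stateB // eta_def -dotvZl -dotvDl -mu_def -step dotvZr.
by rewrite mulVKf.
Qed.

Theorem proposition4 (R : realType) (d : nat) (M S : 'M[R]_d)
  (V : 'cV[R]_d -> R) (h eta : R) (z0 z1 zhat mu : 'cV[R]_d)
  (M_posdef : sym_posdef M)
  (S_struct : S^T = - S \/ negsemidef S)
  (V_diff : forall x : 'cV[R]_d, differentiable V x)
  (h_gt0 : 0 < h)
  (step : h^-1 *: (z1 - z0) = S *m mu)
  (mu_def : mu = M *m (2^-1 *: (z1 + z0)) + eta *: grad V zhat)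
  (eta_def : V z1 - V z0 = eta * dotv (grad V zhat) (z1 - z0)) :
  let H := energy M in
  let y0 := lift_state V z0 in
  let y1 := lift_state V z1 in
  let gH := grad H (2^-1 *: (y0 + y1)) in
  [/\ H y1 - H y0 = h * dotv gH (frozen_struct S V eta zhat *m gH),
      h * dotv gH (frozen_struct S V eta zhat *m gH)
        = h * dotv mu (S *m mu),
      S^T = - S -> H y1 = H y0
    & negsemidef S -> H y1 <= H y0].
Proof.
move=> H y0 y1 gH.
have [symM _] := M_posdef.
have incr : H y1 - H y0 = h * dotv mu (S *m mu).
  by apply: (energy_increment symM _ step mu_def eta_def); rewrite gt_eqF.
have quad : dotv gH (frozen_struct S V eta zhat *m gH) = dotv mu (S *m mu).
  rewrite /gH grad_energy // frozen_struct_quad mu_def.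
  suff -> : usubmx (2^-1 *: (y0 + y1)) = 2^-1 *: (z1 + z0) by [].
  rewrite /y0 /y1 /lift_state add_col_mx scale_col_mx col_mxKu.
  by rewrite (addrC z0).
split; rewrite ?quad //.
- by move=> skewS; apply/eqP; rewrite -subr_eq0 incr dotv_skew // mulr0.
- move=> negS; rewrite -subr_le0 incr pmulr_rle0 //.
  exact: negsemidef_dotv_le0.
Qed.
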